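(* Birkhoff-type algorithms that select permutation matrices with the Max-Min criterion have sparsity $O(\log(1/\epsilon))$. Precisely: for every $n\ge1$ there exist constants $C>0$ and $\epsilon_0\in(0,1)$ such that for every $n\times n$ doubly stochastic matrix $X^\star$ and every $0<\epsilon\le\epsilon_0$, the Max-Min Birkhoff algorithm described in the context, run on $X^\star$, obtains weights and permutation matrices with $\|X^\star-\sum_{i=1}^k\theta_iP_i\|_F\le\epsilon$ using a number of permutation matrices $k\le C\log(1/\epsilon)$.
   Context: A real $n\times n$ matrix is doubly stochastic if its entries are nonnegative and every row and column sums to $1$; a permutation matrix is a doubly stochastic matrix with entries in $\{0,1\}$; $\mathcal P$ is the set of $n\times n$ permutation matrices. $X(a,b)$ is the $(a,b)$ entry of $X$ and $\|X\|_F=\sqrt{\sum_{a,b}|X(a,b)|^2}$. Max-Min Birkhoff algorithm: start with $X_0=0$; while $\|X_{k-1}-X^\star\|_F>\epsilon$, let $(\theta_k,P_k)$ be any solution of the problem of maximizing $\theta$ over $\theta>0$, $P\in\mathcal P$ subject to $X_{k-1}(a,b)+\theta P(a,b)\le X^\star(a,b)$ for all $a,b\in\{1,\dots,n\}$ (equivalently, $P_k$ maximizes over $P\in\mathcal P$ the quantity $\min_{a,b:\,P(a,b)=1}\,(X^\star(a,b)-X_{k-1}(a,b))$ and $\theta_k$ is the maximal value), and set $X_k=X_{k-1}+\theta_kP_k$. The $O(\cdot)$ is for fixed $n$ as $\epsilon\to0$. *)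

(* Defs.v *)
From mathcomp Require Import all_boot all_order all_algebra fingroup perm.
From mathcomp Require Import reals exp.

Set Implicit Arguments.
Unset Strict Implicit.
Unset Printing Implicit Defensive.

Import Order.TTheory GRing.Theory Num.Theory.

Local Open Scope ring_scope.

Definition doubly_stochastic (R : realType) (n : nat) (X : 'M[R]_n) : Prop :=
  [/\ forall a b, 0 <= X a b,
      forall a, \sum_b X a b = 1 &
      forall b, \sum_a X a b = 1].

(* The library's permutation matrices are exactly the doubly stochastic
   matrices with entries in {0, 1}. *)
Lemma is_perm_mx_doubly_stochastic (R : realType) (n : nat) (P : 'M[R]_n) :
  is_perm_mx P <->
  doubly_stochastic P /\ (forall a b, P a b = 0 \/ P a b = 1).
Proof.
split=> [/is_perm_mxP[s ->]|[[P0 Pr Pc] P01]].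
  have E a b : (perm_mx s : 'M[R]_n) a b = (s a == b)%:R by rewrite !mxE.
  split; first split=> [a b|a|b].
  - by rewrite E ler0n.
  - rewrite (bigD1 (s a)) //= E eqxx big1 ?addr0 // => b nb.
    by rewrite E eq_sym (negbTE nb).
  - rewrite (bigD1 (s^-1%g b)) //= E permKV eqxx big1 ?addr0 // => a na.
    by rewrite E -(inj_eq (@perm_inj _ s^-1%g)) permK (negbTE na).
  by move=> a b; rewrite E; case: eqP; [right | left].
have ex a : exists b, P a b == 1.
  apply/existsP; apply: contraT; rewrite negb_exists => /forallP H.
  have := Pr a; rewrite big1 => [/esym/eqP|b _]; first by rewrite oner_eq0.
  by case: (P01 a b) => // /eqP; rewrite (negbTE (H b)).
pose f a := xchoose (ex a).
have fP a : P a (f a) = 1 by apply/eqP; exact: (xchooseP (ex a)).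
have f_inj : injective f.
  move=> a a' ff; apply/eqP; apply: contraT => ne.
  have := Pc (f a); rewrite (bigD1 a) //= (bigD1 a') /=; last by rewrite eq_sym.
  rewrite {2}ff !fP addrA => E.
  have : (1 + 1 : R) <= 1 by rewrite -{3}E lerDl sumr_ge0.
  by rewrite gerDl ler10.
apply/is_perm_mxP; exists (perm f_inj); apply/matrixP => a b.
rewrite !mxE permE; case: eqP => [<-|/eqP ne]; first exact: fP.
case: (P01 a b) => // Pab.
have := Pr a; rewrite (bigD1 (f a)) //= (bigD1 b) /=; last by rewrite eq_sym.
rewrite fP Pab addrA => E.
have : (1 + 1 : R) <= 1 by rewrite -{3}E lerDl sumr_ge0.
by rewrite gerDl ler10.
Qed.

(* The library's norm on matrices is the max norm, hence this definition. *)
Definition frobenius_norm (R : realType) (n : nat) (X : 'M[R]_n) : R :=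
  Num.sqrt (\sum_a \sum_b `|X a b| ^+ 2).

Definition maxmin_feasible (R : realType) (n : nat) (Xs X : 'M[R]_n)
    (theta : R) (P : 'M[R]_n) : Prop :=
  [/\ 0 < theta, is_perm_mx P & forall a b, X a b + theta * P a b <= Xs a b].

Definition maxmin_solution (R : realType) (n : nat) (Xs X : 'M[R]_n)
    (theta : R) (P : 'M[R]_n) : Prop :=
  maxmin_feasible Xs X theta P /\
  forall (theta' : R) (P' : 'M[R]_n),
    maxmin_feasible Xs X theta' P' -> theta' <= theta.

(* A sequence [:: (theta_1, P_1); ...; (theta_k, P_k)] encodes k steps of the
   algorithm; this is X_k. *)
Definition birkhoff_sum (R : realType) (n : nat) (s : seq (R * 'M[R]_n)) :
    'M[R]_n :=
  \sum_(x <- s) x.1 *: x.2.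

(* s records the steps of a possibly unfinished execution: a step is only
   performed when the stopping test fails, and ties between solutions are
   broken arbitrarily. *)
Inductive maxmin_run (R : realType) (n : nat) (Xs : 'M[R]_n) (eps : R) :
    seq (R * 'M[R]_n) -> Prop :=
| maxmin_start : maxmin_run Xs eps [::]
| maxmin_step (s : seq (R * 'M[R]_n)) (theta : R) (P : 'M[R]_n) :
    maxmin_run Xs eps s ->
    eps < frobenius_norm (birkhoff_sum s - Xs) ->
    maxmin_solution Xs (birkhoff_sum s) theta P ->
    maxmin_run Xs eps (rcons s (theta, P)).

(* The stopping test holds at the end of s, so the algorithm returns s. *)
Definition maxmin_output (R : realType) (n : nat) (Xs : 'M[R]_n) (eps : R)
    (s : seq (R * 'M[R]_n)) : Prop :=
  maxmin_run Xs eps s /\ frobenius_norm (Xs - birkhoff_sum s) <= eps.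

(* Main.v *)
Require Import Defs.
From mathcomp Require Import all_boot all_order all_algebra perm.
From mathcomp Require Import reals sequences exp.
From mathcomp Require Import lra zify.

(** After k steps the residual X* - X_k is nonnegative and all its rows and
    columns have the same sum r_k, because each step removes theta_k times a
    permutation matrix. The whole argument rests on one estimate: a nonnegative
    n x n matrix with all margins equal to r > 0 has a permutation along which
    every entry is at least r / n^2 ([bottleneck_perm]). Otherwise, by Hall's
    theorem ([hall_marriage]), some set S of rows would have fewer than #|S|
    columns N containing an entry of S that is at least r / n^2; the mass r #|S|
    of these rows would then be at most r #|N| inside N plus strictly less than
    n^2 (r / n^2) = r outside, whence #|S| < #|N| + 1, a contradiction.

    The Max-Min rule therefore has theta_k >= r_{k-1} / n^2, so that
    r_k <= r_{k-1} (1 - 1 / n^2) and r_k <= exp (- k / n^2)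
    ([maxmin_run_residual]). The Frobenius norm of the residual is at most
    n r_k, since each entry is at most r_k. A further step is made only while
    that norm exceeds eps, which forces k = O(n^2 (n + log (1 / eps)))
    ([maxmin_run_size]). Moreover a residual of positive norm has r_k > 0, so
    the optimization problem of the next step is feasible, and it attains its
    maximum because there are finitely many permutations; with the length bound
    this gives termination ([maxmin_run_complete]). *)

Set Implicit Arguments.
Unset Strict Implicit.
Unset Printing Implicit Defensive.

Import Order.TTheory GRing.Theory Num.Theory.

Local Open Scope ring_scope.

(** * Hall's marriage theorem *)

(** Rado's argument: delete elements from the sets [A i] as long as Hall's
    condition survives. If some [A i0] has two elements x and y, one of them can
    be deleted: a violation for x yields P, one for y yields Q, and the two tight
    inequalities contradict Hall's condition for [i0 |: P :|: Q] and [P :&: Q] by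
    submodularity of the neighbourhood size. When no deletion is possible all
    sets are singletons, and Hall's condition on pairs is injectivity. *)
Lemma hall_marriage (I T : finType) (A : I -> {set T}) :
  (forall S : {set I}, #|S| <= #|\bigcup_(i in S) A i|)%N ->
  exists2 f : I -> T, injective f & forall i, f i \in A i.
Proof.
have [m] := ubnP (\sum_i #|A i|)%N.
elim: m => // m IHm in A * => lt_m hallA.
have [/forallP A_le1|] := boolP [forall i, #|A i| <= 1]%N.
  have A1 i : exists x, A i == [set x].
    suff /cards1P[x ->] : #|A i| == 1%N by exists x.
    by have := hallA [set i]; rewrite big_set1 cards1 eqn_leq A_le1.
  pose f i := xchoose (A1 i).
  have fE i : A i = [set f i] by apply/eqP; exact: (xchooseP (A1 i)).
  exists f => [i j fij|i]; last by rewrite fE set11.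
  apply/eqP; apply: contraT => ij; have := hallA [set i; j].
  by rewrite cards2 ij bigcup_setU !big_set1 !fE fij setUid cards1.
rewrite negb_forall => /existsP[i0]; rewrite -ltnNge => /card_gt1P[x [y]].
move=> [xA yA xy].
pose N B (S : {set I}) := \bigcup_(i in S) B i : {set T}.
pose del z i := if i == i0 then A i :\ z else A i.
have del_lt z : z \in A i0 -> (\sum_i #|del z i| < m)%N.
  move=> zA; rewrite -ltnS; apply: leq_ltn_trans lt_m.
  rewrite (bigD1 i0) //= (bigD1 i0 (F := fun i => #|A i|)) //=.
  rewrite /del eqxx (cardsD1 z (A i0)) zA add1n ltnS leq_add2l.
  by apply: leq_sum => i /negbTE->.
have del_sub z i : del z i \subset A i.
  by rewrite /del; case: eqP => // _; exact: subD1set.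
have del_hall z : z \in A i0 ->
    (forall S : {set I}, #|S| <= #|N (del z) S|)%N ->
    exists2 f : I -> T, injective f & forall i, f i \in A i.
  move=> zA /(IHm (del z) (del_lt z zA))[f f_inj fP]; exists f => // i.
  exact: subsetP (del_sub z i) _ (fP i).
have tight z :
    (forall S : {set I}, #|S| <= #|N (del z) S|)%N \/
    exists P : {set I}, i0 \notin P /\ (#|N A P :|: A i0 :\ z| <= #|P|)%N.
  have [allS|] := boolP [forall S : {set I}, #|S| <= #|N (del z) S|]%N.
    by left; apply/forallP.
  rewrite negb_forall => /existsP[S]; rewrite -ltnNge => ltS; right.
  have NE (Q : {set I}) : i0 \notin Q -> N (del z) Q = N A Q.
    move=> i0Q; apply: eq_bigr => i iQ; rewrite /del; case: eqP => // ii0.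
    by rewrite -ii0 iQ in i0Q.
  have i0S : i0 \in S.
    by apply: contraLR ltS => i0S; rewrite -leqNgt NE.
  exists (S :\ i0); rewrite setD11; split=> //.
  move: ltS; rewrite (cardsD1 i0 S) i0S add1n ltnS /N (big_setD1 i0) //=.
  by rewrite -/(N (del z) _) NE ?setD11 // {1}/del eqxx setUC.
have [/(del_hall x xA)//|[P [i0P leP]]] := tight x.
have [/(del_hall y yA)//|[Q [i0Q leQ]]] := tight y.
set U := N A P :|: _ in leP; set V := N A Q :|: _ in leQ.
(* Here x <> y matters: what is left of [A i0] in U and in V covers [A i0]. *)
have sub_cup : N A (i0 |: P :|: Q) \subset U :|: V.
  apply/bigcupsP => i; rewrite !inE -orbA => /or3P[/eqP->|iP|iQ].
  - apply/subsetP => t tA; rewrite !inE tA !andbT.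
    by have [->|] := eqVneq t x; rewrite ?xy ?orbT.
  - by rewrite /U -setUA subsetU // (bigcup_sup i).
  - by rewrite /V setUCA subsetU // (bigcup_sup i).
have sub_cap : N A (P :&: Q) \subset U :&: V.
  apply/bigcupsP => i; rewrite inE => /andP[iP iQ].
  by rewrite subsetI /U /V !subsetU // (bigcup_sup i).
have := leq_trans (hallA _) (subset_leq_card sub_cup).
have := leq_trans (hallA _) (subset_leq_card sub_cap).
have := cardsUI U V; have := cardsUI P Q.
rewrite -setUA cardsU1 !inE (negbTE i0P) (negbTE i0Q) /=.
lia.
Qed.

(** * Nonnegative matrices with constant margins *)

(** The invariant of the residual: r times a doubly stochastic matrix, in a form
    that does not divide by r, so that r = 0 is included. *)
Definition has_margins (R : realType) (n : nat) (r : R) (A : 'M[R]_n) : Prop :=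
  [/\ forall a b, 0 <= A a b,
      forall a, \sum_b A a b = r &
      forall b, \sum_a A a b = r].

Lemma has_margins_ge0 (R : realType) (n : nat) (r : R) (A : 'M[R]_n) :
  (0 < n)%N -> has_margins r A -> 0 <= r.
Proof.
move=> n_gt0 [A0 rowA _]; rewrite -(rowA (Ordinal n_gt0)); exact: sumr_ge0.
Qed.

Lemma has_margins_le (R : realType) (n : nat) (r : R) (A : 'M[R]_n) a b :
  has_margins r A -> A a b <= r.
Proof.
by case=> A0 rowA _; rewrite -(rowA a) (bigD1 b) //= lerDl; exact: sumr_ge0.
Qed.

Lemma frobenius_norm_le (R : realType) (n : nat) (r : R) (A : 'M[R]_n) :
  (0 < n)%N -> has_margins r A -> frobenius_norm A <= n%:R * r.
Proof.
move=> n_gt0 mA; have r0 := has_margins_ge0 n_gt0 mA.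
have nr0 : 0 <= n%:R * r by rewrite mulr_ge0.
rewrite -[leRHS](ger0_norm nr0) -sqrtr_sqr; apply: ler_wsqrtr.
apply: (@le_trans _ _ (\sum_(a < n) \sum_(b < n) r ^+ 2)).
  apply: ler_sum => a _; apply: ler_sum => b _.
  case: (mA) => A0 _ _; rewrite ger0_norm // lerXn2r ?nnegrE //.
  exact: has_margins_le.
by rewrite !sumr_const card_ord -mulrnA exprMn -natrX mulr_natl -mulnn.
Qed.

Lemma frobenius_normC (R : realType) (n : nat) (A B : 'M[R]_n) :
  frobenius_norm (A - B) = frobenius_norm (B - A).
Proof.
congr Num.sqrt; apply: eq_bigr => a _; apply: eq_bigr => b _.
by rewrite !mxE distrC.
Qed.

(** Apply Hall's theorem to the sets of columns where a row is at least r / n^2;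
    a violating set of rows would have too little mass. *)
Lemma bottleneck_perm (R : realType) (n : nat) (r : R) (A : 'M[R]_n) :
  (0 < n)%N -> 0 < r -> has_margins r A ->
  exists s : 'S_n, forall a, r / n%:R ^+ 2 <= A a (s a).
Proof.
move=> n_gt0 r_gt0 [A0 rowA colA]; set d := r / _.
pose B a := [set b | d <= A a b].
suff hallB (S : {set 'I_n}) : (#|S| <= #|\bigcup_(a in S) B a|)%N.
  have [f f_inj fB] := hall_marriage hallB.
  by exists (perm f_inj) => a; rewrite permE; have := fB a; rewrite inE.
set N := \bigcup_(a in S) B a; rewrite leqNgt; apply/negP => ltNS.
(* S and the complement of N are nonempty, which makes the bound on the mass
   outside N strict. *)
have [a0 a0S] : exists a, a \in S.
  by apply/set0Pn; apply: contraTneq ltNS => ->; rewrite cards0.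
have [b0 b0N] : exists b, b \notin N.
  have : N != setT.
    apply: contraTneq ltNS => ->.
    by rewrite -leqNgt cardsT card_ord -[leqRHS]card_ord max_card.
  by rewrite -subTset => /subsetPn[b _ bN]; exists b.
have small a b : a \in S -> b \notin N -> A a b < d.
  move=> aS; rewrite ltNge; apply: contra => leA.
  by apply/bigcupP; exists a; rewrite ?inE.
have sumS : \sum_(a in S) \sum_b A a b = #|S|%:R * r.
  by rewrite (eq_bigr (fun=> r)) // sumr_const mulr_natl.
have sumN : \sum_(a in S) \sum_(b in N) A a b <= #|N|%:R * r.
  rewrite exchange_big /= mulr_natl -sumr_const; apply: ler_sum => b _.
  by rewrite -(colA b) [leRHS](bigID (mem S)) /= lerDl sumr_ge0.
have sumNC : \sum_(a in S) \sum_(b | b \notin N) A a b < r.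
  apply: (@lt_le_trans _ _ (\sum_(a in S) \sum_(b | b \notin N) d)).
    apply: ltr_sum => [|a aS].
      by apply/hasP; exists a0; rewrite ?mem_index_enum.
    apply: ltr_sum => [|b bN]; last exact: small.
    by apply/hasP; exists b0; rewrite ?mem_index_enum.
  have d0 : 0 <= d by rewrite divr_ge0 ?exprn_ge0 ?(ltW r_gt0).
  apply: (@le_trans _ _ (\sum_(a < n) \sum_(b < n) d)).
    rewrite [leRHS](bigID (mem S)) /= ler_wpDr //.
      by apply: sumr_ge0 => a _; exact: sumr_ge0.
    apply: ler_sum => a _.
    by rewrite [leRHS](bigID (mem N)) /= ler_wpDl ?sumr_ge0.
  rewrite !sumr_const card_ord -mulrnA -[leLHS]mulr_natr mulnn natrX divfK //.
  by rewrite expf_neq0 // pnatr_eq0 -lt0n.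
have : #|S|%:R * r < #|N|%:R * r + r.
  rewrite -sumS (eq_bigr (fun a => \sum_(b in N) A a b
                        + \sum_(b | b \notin N) A a b)) => [|a _].
    by rewrite big_split /= ler_ltD.
  by rewrite (bigID (mem N)).
rewrite -[X in _ + X]mul1r -mulrDl ltr_pM2r // natr1 ltr_nat ltnS leqNgt.
by rewrite ltNS.
Qed.

(** * The Max-Min step *)

(** Off the support of the permutation matrix the constraints only say that the
    residual is nonnegative. *)
Lemma maxmin_feasible_perm_mx (R : realType) (n : nat) (Xs X : 'M[R]_n)
    (theta : R) (s : 'S_n) :
  (forall a b, X a b <= Xs a b) ->
  maxmin_feasible Xs X theta (perm_mx s) <->
  0 < theta /\ forall a, theta <= Xs a (s a) - X a (s a).
Proof.
move=> leX; split=> [[th0 _ le_th]|[th0 le_th]].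
  split=> // a; rewrite lerBrDl.
  by have := le_th a (s a); rewrite !mxE eqxx mulr1.
split=> // [|a b]; first exact: perm_mx_is_perm.
rewrite !mxE; case: eqP => [<-|_]; last by rewrite mulr0 addr0.
by rewrite mulr1 -lerBrDl.
Qed.

(** For a fixed permutation the best theta is the least residual entry along it,
    and there are finitely many permutations. The initial feasible pair ensures
    that the best value is positive. *)
Lemma maxmin_solution_exists (R : realType) (n : nat) (Xs X : 'M[R]_n)
    (theta0 : R) (P0 : 'M[R]_n) :
  (0 < n)%N -> (forall a b, X a b <= Xs a b) ->
  maxmin_feasible Xs X theta0 P0 ->
  exists theta P, maxmin_solution Xs X theta P.
Proof.
move=> n_gt0 leX feas0.
pose gap (s : 'S_n) a := Xs a (s a) - X a (s a).
pose worst s := [arg min_(a < Ordinal n_gt0) gap s a]%O.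
have worstP s a : gap s (worst s) <= gap s a.
  by rewrite /worst; case: arg_minP => // i _; apply.
pose best := [arg max_(s > (1%g : 'S_n)) gap s (worst s)]%O.
have bestP s : gap s (worst s) <= gap best (worst best).
  by rewrite /best; case: arg_maxP => // i _; apply.
have le_best theta P :
    maxmin_feasible Xs X theta P -> theta <= gap best (worst best).
  move=> feas; have [_ /is_perm_mxP[s defP] _] := feas.
  move: feas; rewrite defP => /(maxmin_feasible_perm_mx _ _ leX)[_ le_th].
  exact: le_trans (le_th _) (bestP s).
exists (gap best (worst best)), (perm_mx best); split=> [|theta P]; last first.
  exact: le_best.
apply/(maxmin_feasible_perm_mx _ _ leX); split; last exact: worstP.
by case: (feas0) => th0 _ _; apply: lt_le_trans th0 (le_best _ _ feas0).
Qed.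

(** A Max-Min step removes a fixed fraction of the remaining margin, as it does
    at least as well as the permutation of [bottleneck_perm]. *)
Lemma maxmin_step_ge (R : realType) (n : nat) (Xs X : 'M[R]_n) (r theta : R)
    (P : 'M[R]_n) :
  (0 < n)%N -> has_margins r (Xs - X) -> maxmin_solution Xs X theta P ->
  r / n%:R ^+ 2 <= theta.
Proof.
move=> n_gt0 mA [[th0 _ _] th_max].
have [r_gt0|r_le0] := ltP 0 r; last first.
  by apply: le_trans (ltW th0); rewrite mulr_le0_ge0 // invr_ge0 exprn_ge0.
have [s les] := bottleneck_perm n_gt0 r_gt0 mA.
apply: (th_max _ (perm_mx s)); apply/maxmin_feasible_perm_mx => [a b|].
  by case: mA => /(_ a b) + _ _; rewrite !mxE subr_ge0.
split=> [|a]; first by rewrite divr_gt0 // exprn_gt0 // ltr0n.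
by have := les a; rewrite !mxE.
Qed.

(** * Runs of the algorithm *)

Lemma birkhoff_sum_rcons (R : realType) (n : nat) (s : seq (R * 'M[R]_n))
    (theta : R) (P : 'M[R]_n) :
  birkhoff_sum (rcons s (theta, P)) = birkhoff_sum s + theta *: P.
Proof. by rewrite /birkhoff_sum big_rcons. Qed.

(** Geometric decay of the margin, written with an exponential through
    1 - x <= exp (- x): this also covers n = 1, where 1 - 1 / n^2 vanishes and
    has no logarithm. *)
Lemma maxmin_run_residual (R : realType) (n : nat) (Xs : 'M[R]_n) (eps : R)
    (s : seq (R * 'M[R]_n)) :
  (0 < n)%N -> doubly_stochastic Xs -> maxmin_run Xs eps s ->
  exists2 r, has_margins r (Xs - birkhoff_sum s) &
    r <= expR (- ((size s)%:R / n%:R ^+ 2)).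
Proof.
move=> n_gt0 dsX; elim=> [|{}s theta P _ [r mA le_r] _ sol].
  by exists 1; rewrite /birkhoff_sum ?big_nil ?subr0 //= mul0r oppr0 expR0.
have [[_ permP leX] _] := sol.
have [[_ rowP colP] _] := (is_perm_mx_doubly_stochastic P).1 permP.
have [_ rowA colA] := mA.
exists (r - theta).
  rewrite birkhoff_sum_rcons opprD addrA; split=> [a b|a|b].
  - by have := leX a b; rewrite !mxE -addrA -opprD subr_ge0.
  - transitivity (\sum_b ((Xs - birkhoff_sum s) a b - theta * P a b)).
      by apply: eq_bigr => b _; rewrite !mxE.
    by rewrite sumrB rowA -mulr_sumr rowP mulr1.
  - transitivity (\sum_a ((Xs - birkhoff_sum s) a b - theta * P a b)).
      by apply: eq_bigr => a _; rewrite !mxE.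
    by rewrite sumrB colA -mulr_sumr colP mulr1.
apply: (@le_trans _ _ (r * (1 - n%:R ^- 2))).
  rewrite mulrBr mulr1 lerD2l lerN2; exact: maxmin_step_ge mA sol.
rewrite size_rcons -natr1 mulrDl opprD expRD mul1r.
apply: (le_trans _ (ler_wpM2r _ le_r)); last exact: expR_ge0.
apply: ler_wpM2l (expR_ge1Dx _); exact: has_margins_ge0 mA.
Qed.

(** The last step was made, so the residual before it had norm above eps and
    its margin was above eps / n; the decay of the margin bounds the number of
    earlier steps. The first summand 1 counts the last step. *)
Lemma maxmin_run_size (R : realType) (n : nat) (Xs : 'M[R]_n) (eps : R)
    (s : seq (R * 'M[R]_n)) :
  (0 < n)%N -> doubly_stochastic Xs -> 0 < eps <= 1 -> maxmin_run Xs eps s ->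
  (size s)%:R <= 1 + n%:R ^+ 2 * (n%:R + ln (1 / eps)).
Proof.
move=> n_gt0 dsX /andP[eps_gt0 eps_le1].
have n2_gt0 : 0 < n%:R ^+ 2 :> R by rewrite exprn_gt0 // ltr0n.
rewrite div1r lnV ?posrE //; case=> [|{}s theta P run gt_eps _].
  rewrite ler_wpDr // mulr_ge0 ?(ltW n2_gt0) // addr_ge0 // oppr_ge0.
  exact: ln_le0.
have [r mA le_r] := maxmin_run_residual n_gt0 dsX run.
rewrite size_rcons -natr1 addrC lerD2l mulrC -ler_pdivrMr // lerBrDl -lerBrDr.
rewrite -ler_expR lnK ?posrE //; apply: (le_trans (ltW gt_eps)).
rewrite frobenius_normC; apply: (le_trans (frobenius_norm_le n_gt0 mA)).
rewrite expRD; apply: ler_pM => //; first exact: has_margins_ge0 mA.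
(* The factor n of the norm bound is absorbed by n <= exp n. *)
by apply: le_trans (expR_ge1Dx _); rewrite lerDr.
Qed.

Lemma maxmin_run_continue (R : realType) (n : nat) (Xs : 'M[R]_n) (eps : R)
    (s : seq (R * 'M[R]_n)) :
  (0 < n)%N -> doubly_stochastic Xs -> 0 < eps -> maxmin_run Xs eps s ->
  eps < frobenius_norm (birkhoff_sum s - Xs) ->
  exists x, maxmin_run Xs eps (rcons s x).
Proof.
move=> n_gt0 dsX eps_gt0 run gt_eps.
have [r mA _] := maxmin_run_residual n_gt0 dsX run.
have leX a b : birkhoff_sum s a b <= Xs a b.
  by case: mA => /(_ a b) + _ _; rewrite !mxE subr_ge0.
have n_gt0R : 0 < n%:R :> R by rewrite ltr0n.
have r_gt0 : 0 < r.
  rewrite -(pmulr_rgt0 _ n_gt0R).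
  apply: lt_le_trans (frobenius_norm_le n_gt0 mA).
  by rewrite frobenius_normC (lt_trans eps_gt0).
have [p lep] := bottleneck_perm n_gt0 r_gt0 mA.
have feas : maxmin_feasible Xs (birkhoff_sum s) (r / n%:R ^+ 2) (perm_mx p).
  apply/maxmin_feasible_perm_mx => //; split=> [|a].
    by rewrite divr_gt0 ?exprn_gt0.
  by have := lep a; rewrite !mxE.
have [theta [P sol]] := maxmin_solution_exists n_gt0 leX feas.
by exists (theta, P); exact: maxmin_step.
Qed.

(** Extend the run while the stopping test fails; the bound on its length makes
    this process end. *)
Lemma maxmin_run_complete (R : realType) (n : nat) (Xs : 'M[R]_n) (eps : R)
    (s : seq (R * 'M[R]_n)) :
  (0 < n)%N -> doubly_stochastic Xs -> 0 < eps <= 1 -> maxmin_run Xs eps s ->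
  exists t, maxmin_output Xs eps (s ++ t).
Proof.
move=> n_gt0 dsX eps01; have /andP[eps_gt0 _] := eps01.
set B := 1 + n%:R ^+ 2 * (n%:R + ln (1 / eps)).
have [m] := ubnP (Num.bound B - size s)%N.
elim: m s => // m IHm s lt_m run.
have [le_eps|gt_eps] := leP (frobenius_norm (birkhoff_sum s - Xs)) eps.
  by exists [::]; rewrite cats0; split=> //; rewrite frobenius_normC.
have [x run_x] := maxmin_run_continue n_gt0 dsX eps_gt0 run gt_eps.
have size_lt : (size (rcons s x) < Num.bound B)%N.
  have le_B : (size (rcons s x))%:R <= B by exact: maxmin_run_size run_x.
  rewrite -(ltr_nat R); apply: (le_lt_trans le_B); apply: archi_boundP.
  exact: le_trans (ler0n _ _) le_B.
have [|t out] := IHm (rcons s x) _ run_x; last first.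
  by exists (x :: t); rewrite -cat_rcons.
by move: size_lt lt_m; rewrite size_rcons; lia.
Qed.

Theorem corollary1 (R : realType) (n : nat) (n_ge1 : (1 <= n)%N) :
  exists C eps0 : R,
    [/\ 0 < C, 0 < eps0, eps0 < 1 &
      forall (Xs : 'M[R]_n) (eps : R),
        doubly_stochastic Xs -> 0 < eps -> eps <= eps0 ->
        forall s : seq (R * 'M[R]_n), maxmin_run Xs eps s ->
          (size s)%:R <= C * ln (1 / eps) /\
          exists t : seq (R * 'M[R]_n), maxmin_output Xs eps (s ++ t)].
Proof.
have n2_ge0 : 0 <= n%:R ^+ 2 :> R by rewrite exprn_ge0.
(* With eps <= 1 / e, the logarithm L of 1 / eps is at least 1, which turns
   1 + n^2 (n + L) into a multiple of L. *)
exists (1 + n%:R ^+ 2 * (n%:R + 1)), (expR (- 1)).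
have eps0_lt1 : expR (- 1) < 1 :> R by rewrite expR_lt1 ltrN10.
split=> // [||Xs eps dsX eps_gt0 le_eps0 s run]; last split.
- by rewrite ltr_pwDl // mulr_ge0 // addr_ge0.
- exact: expR_gt0.
- have eps01 : 0 < eps <= 1 by rewrite eps_gt0 (le_trans le_eps0) ?ltW.
  apply: le_trans (maxmin_run_size n_ge1 dsX eps01 run) _.
  have L_ge1 : 1 <= ln (1 / eps).
    by rewrite div1r lnV ?posrE // lerNr -ler_expR lnK ?posrE.
  move: (ln _) L_ge1 => L L_ge1.
  rewrite mulrDl mul1r lerD // -mulrA ler_wpM2l // mulrDl mul1r lerD2r.
  by rewrite ler_peMr.
- apply: (maxmin_run_complete n_ge1) => //.
  by rewrite eps_gt0 (le_trans le_eps0) ?ltW.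
Qed.
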